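(* Let $i\ge1$ with $i\le\frac{2}{7}\left(r+\frac{5}{2}\right)$. Then there exists an injective map $\phi$ from the set of $(i-1)$-subsets of $[r]$ to the set of $i$-subsets of $[r]$ such that $\phi(T)$ dominates $T$ for every $(i-1)$-subset $T$.
   Context: For $\pi=a_1\cdots a_{r+1}\in S_{r+1}$, its descent set is $\{j\in[r]:a_j>a_{j+1}\}$, and $D(S)$ is the set of permutations in $S_{r+1}$ with descent set $S$. The inversion set is $I(\pi)=\{(a_j,a_k):j<k,\ a_j>a_k\}$; $\pi\le_w\pi'$ iff $I(\pi)\subseteq I(\pi')$ (weak Bruhat order). $S$ dominates $T$ if there is an injection $\psi:D(T)\to D(S)$ with $\pi\le_w\psi(\pi)$ for all $\pi\in D(T)$. *)

(* Defs.v *)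
From mathcomp Require Import all_boot all_fingroup.
Set Implicit Arguments. Unset Strict Implicit. Unset Printing Implicit Defensive.

(* Conventions: [r] = {1,...,r} is represented by 'I_r (element j stands for j+1);
   S_{r+1} is {perm 'I_r.+1}; position p (1-based) of a one-line word a_1...a_{r+1}
   is the ordinal p-1, and a_p = s (p-1) (values are shifted down by 1, which does
   not affect comparisons). *)

(* descent set: j (i.e. position j+1 in [r]) is a descent iff a_{j+1} > a_{j+2} *)
Definition descent_set (r : nat) (s : {perm 'I_r.+1}) : {set 'I_r} :=
  [set j : 'I_r | s (lift ord0 j) < s (widen_ord (leqnSn r) j)].

Definition Dset (r : nat) (S : {set 'I_r}) : {set {perm 'I_r.+1}} :=
  [set s | descent_set s == S].

Definition inv_set (n : nat) (s : {perm 'I_n}) : {set 'I_n * 'I_n} :=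
  [set v : 'I_n * 'I_n | [exists j : 'I_n, exists k : 'I_n,
     [&& j < k, s k < s j & v == (s j, s k)]]].

Definition weak_le (n : nat) (s t : {perm 'I_n}) : bool :=
  inv_set s \subset inv_set t.

Definition dominates (r : nat) (S T : {set 'I_r}) : Prop :=
  exists psi : {perm 'I_r.+1} -> {perm 'I_r.+1},
    {in Dset T &, injective psi} /\
    (forall s, s \in Dset T -> psi s \in Dset S /\ weak_le s (psi s)).

(* Main.v *)
Require Import Defs.
From mathcomp Require Import all_boot all_fingroup zify.

(** Flank a permutation by a smallest and a largest letter. Its descents then cut
    the word into runs, and neither the first nor the last position is a cut, so
    the ends need no special treatment. A cut may be added to [T] in three contexts:
    - no neighbouring position is a cut;
    - just before the last letter of a run of length at least 4 that is followed by
      a run of length at least 2;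
    - just before the last letter of a run of length 3 that is preceded by a run of
      length at least 2 and followed by one of length at least 3.
    In each case a few letters around the new cut are rearranged, in a way that
    only creates inversions and can be read off the rearranged letters; this is the
    injection required for domination.

    Let a word of length [n] have [K] cuts and [N] sites where a cut may be added.
    Run by run, [2 N + 5 K - 2 n] increases by 3 at a run of length 1, by 1 at a run
    of length 2, and by 1 or -1 at a longer run, where a loss occurs only at the ends
    of the word or next to a short run that makes up for it. So [7 i <= 2 r + 5]
    forces at least [i] sites when [K = i - 1], whereas a set of size [i] extends at
    most [i] sets of size [i - 1]; the injection [phi] comes from Hall's theorem. *)

Set Implicit Arguments. Unset Strict Implicit. Unset Printing Implicit Defensive.

(** * Hall's theorem *)

Section Hall.

Variables (X Y : finType).
Implicit Types (A B C : {set X}) (F : X -> {set Y}).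

Definition hall_condition A F : bool :=
  [forall (B : {set X} | B \subset A), #|B| <= #|\bigcup_(x in B) F x|].

Lemma hall_conditionP A F :
  reflect (forall B, B \subset A -> #|B| <= #|\bigcup_(x in B) F x|)
          (hall_condition A F).
Proof. exact: forall_inP. Qed.

Definition discard F x y : X -> {set Y} :=
  fun x' => if x' == x then F x :\ y else F x'.

Lemma not_hall_discard A F x y :
  hall_condition A F -> ~~ hall_condition A (discard F x y) ->
  exists B, [/\ B \subset A, x \in B & #|\bigcup_(x' in B) discard F x y x'| < #|B|].
Proof.
move=> /hall_conditionP hallF /forall_inPn[B sBA]; rewrite -ltnNge => ltB.
exists B; split=> //; apply: contraLR ltB => xB; rewrite -leqNgt.
apply: leq_trans (hallF B sBA) (eq_leq _); congr #|pred_of_set _|.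
by apply: eq_bigr => x' x'B; rewrite /discard; case: eqP x'B xB => // -> ->.
Qed.

(* As the number of neighbours is submodular, the union of two violating sets or
   their intersection without [x] would violate the condition for [F]. *)
Lemma hall_discard A F x y z :
  hall_condition A F -> y != z ->
  hall_condition A (discard F x y) || hall_condition A (discard F x z).
Proof.
move=> hallF yz; apply: contraTT isT; rewrite negb_or => /andP[].
move=> /(not_hall_discard hallF)[B [sBA xB ltB]].
move=> /(not_hall_discard hallF)[C [sCA xC ltC]].
pose nbrs F' (E : {set X}) := \bigcup_(x' in E) F' x' : {set Y}.
rewrite -/(nbrs _ B) -/(nbrs _ C) in ltB ltC.
have unionS : nbrs F (B :|: C) \subset nbrs (discard F x y) B :|: nbrs (discard F x z) C.
  apply/bigcupsP=> x' x'BC; apply/subsetP=> v vF; rewrite inE.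
  have [x'x|x'x] := eqVneq x' x.
    rewrite x'x in vF; have [vy|vy] := eqVneq v y; apply/orP; [right | left];
      by apply/bigcupP; exists x; rewrite // /discard eqxx !inE vF ?vy ?yz.
  case/setUP: x'BC => x'BC; apply/orP; [left | right];
    by apply/bigcupP; exists x'; rewrite // /discard (negbTE x'x).
have interS :
    nbrs F ((B :&: C) :\ x) \subset nbrs (discard F x y) B :&: nbrs (discard F x z) C.
  apply/bigcupsP=> x' /setD1P[x'x /setIP[x'B x'C]]; apply/subsetP=> v vF; rewrite inE.
  by apply/andP; split; apply/bigcupP; exists x'; rewrite // /discard (negbTE x'x).
have sBCA : B :|: C \subset A by rewrite subUset sBA.
have sBCxA : (B :&: C) :\ x \subset A.
  by rewrite (subset_trans (subsetDl _ _)) ?(subset_trans (subsetIl _ _)).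
move/hall_conditionP: hallF => hallF.
have := leq_trans (hallF _ sBCA) (subset_leq_card unionS).
have := leq_trans (hallF _ sBCxA) (subset_leq_card interS).
have := cardsUI (nbrs (discard F x y) B) (nbrs (discard F x z) C).
have := cardsUI B C; have := cardsD1 x (B :&: C); rewrite inE xB xC.
lia.
Qed.

Lemma hall_matching (y0 : Y) A F :
  hall_condition A F ->
  exists f : X -> Y, {in A &, injective f} /\ {in A, forall x, f x \in F x}.
Proof.
have [n] := ubnP (\sum_(x in A) #|F x|); elim: n => // n IHn in F * => ltFn hallF.
have [/exists_inP[x xA /card_gt1P[y [z [yF zF yz]]]] | /exists_inPn le1] :=
    boolP [exists x in A, 1 < #|F x|].
  have match_discard v : v \in F x -> hall_condition A (discard F x v) ->
      exists f : X -> Y, {in A &, injective f} /\ {in A, forall x, f x \in F x}.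
    move=> vF hallFv; have [||f [injf fF]] := IHn (discard F x v) => //.
      rewrite -ltnS; apply: leq_trans ltFn; rewrite ltnS (bigD1 x) //=.
      rewrite [ltnRHS](bigD1 x) //= {1}/discard eqxx (cardsD1 v (F x)) vF.
      rewrite add1n ltnS leq_add2l.
      by apply: leq_sum => x' /andP[_ x'x]; rewrite /discard (negbTE x'x).
    exists f; split=> // x' /fF; rewrite /discard.
    by case: eqP => // -> /setD1P[].
  by case/orP: (hall_discard x hallF yz); apply: match_discard.
move/hall_conditionP: hallF => hallF; exists (fun x => odflt y0 [pick y in F x]).
have F_single x : x \in A -> F x = [set odflt y0 [pick y in F x]].
  move=> xA; have /cards1P[y ->] : #|F x| == 1.
    rewrite eqn_leq leqNgt le1 //=.
    by have := hallF [set x]; rewrite sub1set xA cards1 big_set1; apply.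
  by case: pickP => [y' /set1P->|/(_ y)] //; rewrite inE eqxx.
split=> [x x' xA x'A e|x xA]; last by rewrite {2}F_single ?set11.
apply/eqP; apply: contraTT isT => xx'; have := hallF [set x; x'].
rewrite subUset !sub1set xA x'A => /(_ isT); rewrite cards2 xx' bigcup_setU !big_set1.
by rewrite (F_single x xA) (F_single x' x'A) e setUid cards1.
Qed.

Lemma degree_matching (y0 : Y) A F d :
  0 < d -> {in A, forall x, d <= #|F x|} ->
  (forall y, #|[set x in A | y \in F x]| <= d) ->
  exists f : X -> Y, {in A &, injective f} /\ {in A, forall x, f x \in F x}.
Proof.
move=> d_gt0 degX degY; apply: hall_matching => //; apply/hall_conditionP => B sBA.
rewrite -(leq_pmul2r d_gt0) -!sum_nat_const.
apply: (@leq_trans (\sum_(x in B) \sum_(y in F x) 1)).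
  by apply: leq_sum => x xB; rewrite sum1_card degX ?(subsetP sBA).
rewrite (exchange_big_dep [in \bigcup_(x in B) F x]) /= => [|x y xB yF]; last first.
  by apply/bigcupP; exists x.
apply: leq_sum => y _; apply: leq_trans (degY y); rewrite sum1dep_card.
by apply/subset_leq_card/subsetP=> x; rewrite !inE => /andP[/(subsetP sBA)-> ->].
Qed.

End Hall.

(** * Words and their descents *)

Section Words.

Variable n : nat.
Implicit Types s t : {perm 'I_n}.

(* The letters are 1, ..., [n], which leaves 0 for the flanking letter. *)
Definition word s : seq nat := [seq (s x).+1 | x <- enum 'I_n].

Lemma size_word s : size (word s) = n.
Proof. by rewrite size_map size_enum_ord. Qed.

Lemma nth_word s (x : 'I_n) : nth 0 (word s) x = (s x).+1.
Proof. by rewrite (nth_map x) ?size_enum_ord // nth_ord_enum. Qed.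

Lemma word_inj : injective word.
Proof.
move=> s t e; apply/permP=> x; apply: val_inj; apply: succn_inj.
by rewrite -!nth_word e.
Qed.

Lemma perm_word s : perm_eq (word s) (iota 1 n).
Proof.
rewrite (iotaDl 1 0) -val_enum_ord -map_comp; apply: uniq_perm.
- by rewrite map_inj_uniq ?enum_uniq // => x y [/val_inj/perm_inj].
- by rewrite map_inj_uniq ?enum_uniq // => x y [/val_inj].
move=> a; apply/mapP/mapP=> -[x _ ->].
  by exists (s x); rewrite ?mem_enum.
by exists ((s^-1)%g x); rewrite ?mem_enum ?permKV.
Qed.

Lemma word_surj w : perm_eq w (iota 1 n) -> exists s, word s = w.
Proof.
move=> wn; have size_w : size w = n by rewrite (perm_size wn) size_iota.
have nth_w (x : 'I_n) : 0 < nth 0 w x <= n.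
  by have := mem_nth 0 (_ : x < size w); rewrite size_w (perm_mem wn) mem_iota; apply.
have lt_w (x : 'I_n) : (nth 0 w x).-1 < n by have := nth_w x; lia.
have inj_w : injective (fun x => Ordinal (lt_w x)).
  have uniq_w : uniq w by rewrite (perm_uniq wn) iota_uniq.
  move=> x y /(congr1 val)/= e.
  apply/val_inj/(uniqP 0 uniq_w); rewrite ?inE ?size_w ?ltn_ord //.
  by have := nth_w x; have := nth_w y; move: e; case: nth; case: nth => //= a b ->.
exists (perm inj_w); apply: (@eq_from_nth _ 0); rewrite size_word ?size_w // => k kn.
rewrite -[k]/(val (Ordinal kn)) nth_word permE /=.
by have /andP[/prednK] := nth_w (Ordinal kn).
Qed.

End Words.

Definition descents (x : nat) (w : seq nat) : bitseq := pairmap (fun a b => b < a) x w.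

Lemma pairmap_ltn_descents x w :
  uniq (x :: w) -> pairmap ltn x w = [seq ~~ d | d <- descents x w].
Proof.
elim: w x => //= y w IHw x /andP[]; rewrite inE negb_or => /andP[xy _] /IHw->.
by rewrite ltn_neqAle xy leqNgt.
Qed.

Lemma descents_window x w1 v w2 z :
  descents x (rcons (w1 ++ v ++ w2) z) =
  descents x w1 ++ descents (last x w1) (rcons v (head z w2)) ++
  descents (head z w2) (behead (rcons w2 z)).
Proof.
rewrite /descents !rcons_cat pairmap_cat; congr (_ ++ _).
by case: w2 => [|y w2]; rewrite /= ?cats1 ?cats0 // -cat_rcons pairmap_cat last_rcons.
Qed.

Section Cuts.

Variable r : nat.
Implicit Types (S T : {set 'I_r}) (s : {perm 'I_r.+1}).

Definition padded_descents s : bitseq := descents 0 (rcons (word s) r.+2).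

(* The element [j] of ['I_r] occupies position [j + 1], because of the padding. *)
Definition cuts T : bitseq := false :: rcons [seq j \in T | j <- enum 'I_r] false.

Lemma size_cuts T : size (cuts T) = r.+2.
Proof. by rewrite /= size_rcons size_map size_enum_ord. Qed.

Lemma nth_cuts T (j : 'I_r) : nth false (cuts T) j.+1 = (j \in T).
Proof.
rewrite /= nth_rcons size_map size_enum_ord ltn_ord.
by rewrite (nth_map j) ?size_enum_ord // nth_ord_enum.
Qed.

Lemma nth_cuts_last T : nth false (cuts T) r.+1 = false.
Proof. by rewrite /= nth_rcons size_map size_enum_ord ltnn eqxx. Qed.

Lemma cuts_inj : injective cuts.
Proof. by move=> S T e; apply/setP=> j; rewrite -!nth_cuts e. Qed.

Lemma cutsU1 T (j : 'I_r) : cuts (j |: T) = set_nth false (cuts T) j.+1 true.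
Proof.
apply: (@eq_from_nth _ false) => [|[|k]] //; rewrite ?size_set_nth !size_cuts.
  by rewrite (maxn_idPr _) // !ltnS ltnW.
rewrite nth_set_nth -[RHS]/(if k == j then true else nth false (cuts T) k.+1).
rewrite !ltnS leq_eqVlt => /predU1P[->|kr]; first by rewrite !nth_cuts_last gtn_eqF.
by rewrite !(nth_cuts _ (Ordinal kr)) !inE -val_eqE; case: eqP.
Qed.

Lemma count_cuts T : count id (cuts T) = #|T|.
Proof.
rewrite /cuts enumT -cats1 -cat1s !count_cat count_map /= !addn0.
by rewrite [RHS]cardE /enum_mem size_filter; apply: eq_count.
Qed.

Lemma cuts_descent_set s : cuts (descent_set s) = padded_descents s.
Proof.
have size_s := size_word s.
apply: (@eq_from_nth _ false) => [|k]; rewrite size_cuts.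
  by rewrite size_pairmap size_rcons size_s.
rewrite ltnS => kr; rewrite (nth_pairmap 0) ?size_rcons ?size_s //.
case: k kr => [|k]; first by rewrite /= ltn0.
rewrite ltnS leq_eqVlt => /predU1P[->|kr].
  rewrite nth_cuts_last /= !nth_rcons size_s ltnn eqxx ltnSn (nth_word s ord_max).
  by apply/esym/negbTE; rewrite -leqNgt ltnW // ltnS.
rewrite (nth_cuts _ (Ordinal kr)) inE /= !nth_rcons size_s !ltnS kr (ltnW kr).
have := nth_word s (lift ord0 (Ordinal kr)); rewrite lift0 => ->.
have := nth_word s (widen_ord (leqnSn r) (Ordinal kr)); rewrite /= => ->.
by rewrite ltnS.
Qed.

Lemma mem_Dset T s : (s \in Dset T) = (padded_descents s == cuts T).
Proof. by rewrite inE -cuts_descent_set (inj_eq cuts_inj). Qed.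

Lemma split_word_at_window T s c1 D c2 :
  s \in Dset T -> cuts T = c1 ++ D ++ c2 -> 0 < size D ->
  exists w1 v w2, let y := head r.+2 w2 in
    [/\ word s = w1 ++ v ++ w2, descents 0 w1 = c1, descents (last 0 w1) (rcons v y) = D
      & descents y (behead (rcons w2 r.+2)) = c2].
Proof.
rewrite mem_Dset => /eqP sT cT D_gt0; set o := size c1; set m := (size D).-1.
have size_T : size c1 + (size D + size c2) = r.+2 by rewrite -!size_cat -cT size_cuts.
pose w1 := take o (word s); pose v := take m (drop o (word s)).
pose w2 := drop (m + o) (word s).
have size_w1 : size w1 = o by rewrite size_takel // size_word /o; lia.
have size_v : size v = m by rewrite size_takel // size_drop size_word /o /m; lia.
have sE : word s = w1 ++ v ++ w2 by rewrite /w2 -drop_drop !cat_take_drop.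
exists w1, v, w2; move: sT => /=; rewrite /padded_descents sE descents_window cT => /eqP.
rewrite !eqseq_cat ?size_pairmap ?size_rcons ?size_v ?prednK //.
by case/and3P=> /eqP-> /eqP-> /eqP->.
Qed.

End Cuts.

(** * Rearrangements that go up in the weak order *)

Definition rearrange (u w : seq nat) : seq nat := [seq nth 0 w k | k <- u].

Definition reverses_ascents (u w : seq nat) : bool :=
  pairwise (fun k l => (l < k) ==> (nth 0 w l <= nth 0 w k)) u.

Lemma rearrange_inj n u w w' : perm_eq u (iota 0 n) -> size w = n -> size w' = n ->
  rearrange u w = rearrange u w' -> w = w'.
Proof.
move=> un size_w size_w' /eq_in_map e.
apply: (@eq_from_nth _ 0); rewrite size_w ?size_w' // => k kn.
by apply: e; rewrite (perm_mem un) mem_iota.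
Qed.

Lemma perm_rearrange u w : perm_eq u (iota 0 (size w)) -> perm_eq (rearrange u w) w.
Proof. by move=> un; rewrite -[X in perm_eq _ X](mkseq_nth 0) perm_map. Qed.

Lemma weak_le_rearrange n (s t : {perm 'I_n}) u :
  perm_eq u (iota 0 n) -> reverses_ascents u (word s) ->
  word t = rearrange u (word s) -> weak_le s t.
Proof.
move=> un asc tE; have size_u : size u = n by rewrite (perm_size un) size_iota.
have mem_u (x : 'I_n) : nat_of_ord x \in u by rewrite (perm_mem un) mem_iota /=.
have index_lt (x : 'I_n) : index (nat_of_ord x) u < n by rewrite -[ltnRHS]size_u index_mem.
have t_index x : t (Ordinal (index_lt x)) = s x.
  apply/val_inj/succn_inj; rewrite -!nth_word tE (nth_map 0) /= ?size_u ?index_lt //.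
  by rewrite nth_index.
apply/subsetP=> v; rewrite !inE => /existsP[x /existsP[y /and3P[xy syx /eqP->]]].
apply/existsP; exists (Ordinal (index_lt x)).
apply/existsP; exists (Ordinal (index_lt y)).
rewrite !t_index syx eqxx /= andbT ltnNge; apply: contraL syx => index_yx.
rewrite -leqNgt -ltnS -!nth_word.
have /(pairwiseP 0)/(_ (index (nat_of_ord y) u) (index (nat_of_ord x) u)) := asc.
rewrite !inE size_u !index_lt !nth_index // xy; apply=> //.
rewrite ltn_neqAle index_yx andbT; apply: contraTneq xy => e.
by rewrite -(nth_index 0 (mem_u y)) e nth_index // ltnn.
Qed.

Lemma rearrangement_dominates r (S T : {set 'I_r}) (pos unpos : seq nat -> seq nat) :
  {in Dset T, forall s, let w := word s in
     [/\ perm_eq (pos w) (iota 0 r.+1), reverses_ascents (pos w) w,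
         descents 0 (rcons (rearrange (pos w) w) r.+2) = cuts S
       & unpos (rearrange (pos w) w) = pos w]} ->
  dominates S T.
Proof.
move=> posP.
have [psi psiE] : exists psi : {perm 'I_r.+1} -> {perm 'I_r.+1},
    forall s, s \in Dset T -> word (psi s) = rearrange (pos (word s)) (word s).
  apply: (@fin_all_exists _ _ (fun s t => _ -> word t = _)) => s.
  have [/posP[pos_perm _ _ _]|] := boolP (s \in Dset T); last by exists s.
  have [|t] := @word_surj r.+1 (rearrange (pos (word s)) (word s)); last by exists t.
  by rewrite (perm_trans _ (perm_word s)) // perm_rearrange // size_word.
exists psi; split=> [s t sT tT e|s sT].
  have [pos_perm _ _ unpos_s] := posP s sT; have [_ _ _ unpos_t] := posP t tT.
  have /(congr1 (@word _)) := e; rewrite !psiE // => ew.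
  apply/word_inj/(rearrange_inj pos_perm); rewrite ?size_word //.
  by rewrite ew -unpos_s ew unpos_t.
have [pos_perm asc desc _] := posP s sT.
split; last exact: weak_le_rearrange asc (psiE s sT).
by rewrite mem_Dset /padded_descents psiE // desc.
Qed.

Section ExtendWindow.

Definition extend_window (o : nat) (u : seq nat) (n : nat) : seq nat :=
  iota 0 o ++ [seq o + k | k <- u] ++ iota (o + size u) (n - (o + size u)).

Variables (u w1 v w2 : seq nat).
Hypothesis perm_u : perm_eq u (iota 0 (size v)).
Let w := w1 ++ v ++ w2.

Let size_u : size u = size v.
Proof. by rewrite (perm_size perm_u) size_iota. Qed.

Lemma perm_extend_window :
  perm_eq (extend_window (size w1) u (size w)) (iota 0 (size w)).
Proof.
rewrite /extend_window size_u !size_cat addnA addKn !iotaD -catA !add0n perm_cat2l.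
by rewrite perm_cat2r -[in X in perm_eq _ X](addn0 (size w1)) iotaDl perm_map.
Qed.

Lemma rearrange_extend_window :
  rearrange (extend_window (size w1) u (size w)) w = w1 ++ rearrange u v ++ w2.
Proof.
rewrite /rearrange /extend_window size_u !map_cat -map_comp; congr (_ ++ _ ++ _).
- by rewrite map_nth_iota0 ?take_size_cat // !size_cat leq_addr.
- apply/eq_in_map=> k; rewrite (perm_mem perm_u) mem_iota /= => kv.
  by rewrite nth_cat ltnNge leq_addr addKn nth_cat kv.
rewrite map_nth_iota // -size_cat /w catA drop_size_cat //.
by rewrite take_oversize // [size (_ ++ w2)]size_cat addKn.
Qed.

Lemma reverses_ascents_extend_window :
  reverses_ascents u v -> reverses_ascents (extend_window (size w1) u (size w)) w.
Proof.
have iota_reverses o n : reverses_ascents (iota o n) w.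
  apply: sub_pairwise (_ : pairwise ltn (iota o n)) => [k l /= kl|].
    by rewrite ltnNge ltnW.
  by rewrite -(sorted_pairwise ltn_trans) iota_ltn_sorted.
move=> asc; rewrite /reverses_ascents !pairwise_cat -!/(reverses_ascents _ _).
rewrite !iota_reverses andbT /=; apply/and3P; split.
- apply/allrelP=> k l; rewrite mem_iota /= => kw1.
  rewrite mem_cat => /orP[/mapP[i _ ->]|]; last by rewrite mem_iota; lia.
  by rewrite ltnNge (leq_trans (ltnW kw1)) ?leq_addr.
- apply/allrelP=> k l /mapP[i]; rewrite (perm_mem perm_u) -size_u mem_iota /= => iu ->.
  by rewrite mem_iota; lia.
rewrite /reverses_ascents pairwise_map; move: asc.
apply: (@sub_in_pairwise _ [pred k | k < size v]) => [k l|]; last first.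
  by apply/allP=> k; rewrite (perm_mem perm_u) mem_iota.
rewrite !inE /= => kv lv.
by rewrite ltn_add2l !nth_cat !ltnNge !leq_addr /= !addKn -!ltnNge kv lv.
Qed.

End ExtendWindow.

(* The letters [x] and [y] at the ends of the window stay in place. Injectivity comes
   from [unrule], which recovers the rearrangement from its result. *)
Definition raising_rule (D D' : bitseq) (rule unrule : seq nat -> seq nat) : Prop :=
  forall x w y, uniq w -> descents x (rcons w y) = D ->
    let u := rule w in
    [/\ perm_eq u (iota 0 (size w)), reverses_ascents u w,
        descents x (rcons (rearrange u w) y) = D' & unrule (rearrange u w) = u].

Lemma raising_rule_dominates r (S T : {set 'I_r}) D D' rule unrule c1 c2 :
  raising_rule D D' rule unrule -> 0 < size D ->
  cuts T = c1 ++ D ++ c2 -> cuts S = c1 ++ D' ++ c2 -> dominates S T.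
Proof.
move=> ruleP D_gt0 cT cS; set o := size c1; set m := (size D).-1.
pose extend f (w : seq nat) := extend_window o (f (take m (drop o w))) r.+1.
apply: (@rearrangement_dominates _ _ _ (extend rule) (extend unrule)) => s sT.
have [w1 [v [w2 [sE d1 dv d2]]]] := split_word_at_window sT cT D_gt0.
have size_w1 : size w1 = o by rewrite /o -d1 size_pairmap.
have size_v : size v = m by rewrite /m -dv size_pairmap size_rcons.
move: (size_word s) (perm_word s); rewrite sE; set w := w1 ++ v ++ w2 => size_w perm_w.
have uniq_v : uniq v.
  have : uniq w by rewrite (perm_uniq perm_w) iota_uniq.
  by rewrite !cat_uniq => /and3P[_ _ /and3P[]].
have extendE f v' : size v' = size v ->
    extend f (w1 ++ v' ++ w2) = extend_window (size w1) (f v') (size w).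
  move=> size_v'; rewrite /extend -size_w1 -size_v -size_v' size_w.
  by rewrite drop_size_cat // take_size_cat.
have [perm_u asc_u desc_u unrule_u] := ruleP _ _ _ uniq_v dv.
have size_u : size (rule v) = size v by rewrite (perm_size perm_u) size_iota.
rewrite extendE // rearrange_extend_window //; split.
- by have := perm_extend_window w1 w2 perm_u; rewrite -/w size_w.
- exact: reverses_ascents_extend_window.
- by rewrite descents_window d1 desc_u d2.
- by rewrite extendE ?size_map // unrule_u.
Qed.

(** * The contexts in which a cut may be added *)

(* A context consists of the bits before and after the position of the new cut. *)
Definition fill (e : bitseq * bitseq) (b : bool) : bitseq := e.1 ++ b :: e.2.

Definition isolated_context : bitseq * bitseq := ([:: false], [:: false]).

Definition long_run_context : bitseq * bitseq := ([:: false; false], [:: true; false]).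

Definition run3_context : bitseq * bitseq :=
  ([:: false; true; false], [:: true; false; false]).

Definition swap_rule (_ : seq nat) : seq nat := [:: 1; 0].

Lemma swap_raising_rule :
  raising_rule (fill isolated_context false) (fill isolated_context true)
    swap_rule swap_rule.
Proof.
move=> x [|a [|b [|? []]]] y // /pairmap_ltn_descents[ab] [xa ba yb].
split=> //; first by rewrite /reverses_ascents /=; lia.
by rewrite /=; congr [:: _; _; _]; lia.
Qed.

Definition long_run_rule (w : seq nat) : seq nat :=
  if nth 0 w 1 < nth 0 w 3 then [:: 0; 2; 3; 1]
  else if nth 0 w 0 < nth 0 w 3 then [:: 1; 2; 3; 0] else [:: 0; 2; 1; 3].

Definition long_run_unrule (w : seq nat) : seq nat :=
  if nth 0 w 0 < nth 0 w 3 then [:: 0; 2; 3; 1]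
  else if nth 0 w 2 <= nth 0 w 0 then [:: 1; 2; 3; 0] else [:: 0; 2; 1; 3].

Lemma long_run_raising_rule :
  raising_rule (fill long_run_context false) (fill long_run_context true)
    long_run_rule long_run_unrule.
Proof.
move=> x [|a [|b [|c [|d [|? []]]]]] y //.
move=> /pairmap_ltn_descents[ab bc cd] [xa ba cb dc yd].
rewrite /long_run_rule /=; case: ifP => bd; [|case: ifP => ad];
  (split=> //=; [ by rewrite /reverses_ascents /=; lia
                | by congr [:: _; _; _; _; _]; lia | rewrite /long_run_unrule /=]).
- by rewrite ifT //; lia.
- by rewrite ifF ?ifT //; lia.
- by rewrite !ifF //; lia.
Qed.

Definition run3_rule (w : seq nat) : seq nat :=
  if (nth 0 w 2 < nth 0 w 0) && (nth 0 w 4 < nth 0 w 1) then [:: 0; 2; 3; 1; 4; 5]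
  else if nth 0 w 4 < nth 0 w 2 then [:: 0; 1; 3; 2; 4; 5]
  else if nth 0 w 4 < nth 0 w 0 then [:: 0; 2; 3; 4; 1; 5] else [:: 3; 0; 5; 4; 1; 2].

Definition run3_unrule (w : seq nat) : seq nat :=
  if nth 0 w 3 < nth 0 w 1 then [:: 0; 2; 3; 1; 4; 5]
  else if ~~ ((nth 0 w 3 < nth 0 w 0) && (nth 0 w 4 < nth 0 w 1)) then [:: 0; 1; 3; 2; 4; 5]
  else if nth 0 w 3 < nth 0 w 5 then [:: 0; 2; 3; 4; 1; 5] else [:: 3; 0; 5; 4; 1; 2].

Lemma run3_raising_rule :
  raising_rule (fill run3_context false) (fill run3_context true) run3_rule run3_unrule.
Proof.
move=> x [|a [|b [|c [|d [|e [|f [|? []]]]]]]] y //.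
move=> /pairmap_ltn_descents[ab bc cd de ef] [xa ba cb dc ed fe yf].
rewrite /run3_rule /=; case: ifP => ca_eb; [|case: ifP => ec; [|case: ifP => ea]];
  (split=> //=; [ by rewrite /reverses_ascents /=; lia
                | by congr [:: _; _; _; _; _; _; _]; lia | rewrite /run3_unrule /=]).
- by rewrite ifT //; lia.
- by rewrite ifF ?ifT //; lia.
- by rewrite 2?ifF ?ifT //; lia.
- by rewrite !ifF //; lia.
Qed.

Definition insertion_contexts : seq (bitseq * bitseq) :=
  [:: isolated_context; long_run_context; run3_context].

Lemma insertion_context_raising_rule e : e \in insertion_contexts ->
  exists rule unrule, raising_rule (fill e false) (fill e true) rule unrule.
Proof.
rewrite !inE => /or3P[]/eqP->.
- by exists swap_rule, swap_rule; apply: swap_raising_rule.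
- by exists long_run_rule, long_run_unrule; apply: long_run_raising_rule.
- by exists run3_rule, run3_unrule; apply: run3_raising_rule.
Qed.

(** * Counting the insertion sites *)

Definition occurrences (P c : bitseq) : seq nat :=
  [seq o <- iota 0 (size c) | prefix P (drop o c)].

Lemma size_occurrences_cons P x c :
  size (occurrences P (x :: c)) = prefix P (x :: c) + size (occurrences P c).
Proof. by rewrite !size_filter /= (iotaDl 1 0) count_map. Qed.

Lemma split_at_occurrence P c o : o \in occurrences P c ->
  exists c1 c2, c = c1 ++ P ++ c2 /\ size c1 = o.
Proof.
rewrite mem_filter mem_iota /= => /andP[/prefixP[c2 Pc2] oc].
by exists (take o c), c2; rewrite -Pc2 cat_take_drop size_takel // ltnW.
Qed.

Definition insertion_sites (c : bitseq) : seq nat :=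
  [seq o + size e.1 | e <- insertion_contexts, o <- occurrences (fill e false) c].
Arguments insertion_sites : simpl never.

Lemma split_at_insertion_site c a : a \in insertion_sites c ->
  exists e c1 c2, [/\ e \in insertion_contexts, c = c1 ++ fill e false ++ c2
                    & a = size (c1 ++ e.1)].
Proof.
case/allpairsPdep=> e [o [eC /split_at_occurrence[c1 [c2 [cE <-]]] ->]].
by exists e, c1, c2; rewrite size_cat.
Qed.

Lemma insertion_context_unique e e' c1 c2 c1' c2' :
  e \in insertion_contexts -> e' \in insertion_contexts ->
  c1 ++ fill e false ++ c2 = c1' ++ fill e' false ++ c2' ->
  size (c1 ++ e.1) = size (c1' ++ e'.1) -> e = e'.
Proof.
move=> eC e'C cE size_eq; move/eqP: cE; rewrite /fill -!catA !(catA c1) !(catA c1').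
rewrite eqseq_cat // => /andP[/eqP/(congr1 rev) + /eqP]; rewrite !rev_cat {size_eq}.
by move: eC e'C; rewrite !inE => /or3P[]/eqP-> /or3P[]/eqP->.
Qed.

Lemma uniq_insertion_sites c : uniq (insertion_sites c).
Proof.
apply: allpairs_uniq_dep => // [e _|]; first by rewrite filter_uniq ?iota_uniq.
have mem_sites p :
    p \in [seq @Tagged _ e (fun=> nat) o
          | e <- insertion_contexts, o <- occurrences (fill e false) c] ->
    tag p \in insertion_contexts /\ tagged p \in occurrences (fill (tag p) false) c.
  by case/allpairsPdep=> e [o [eC oc ->]].
move=> [e o] [e' o'] /mem_sites/=[eC /split_at_occurrence[c1 [c2 [cE size_c1]]]].
move=> /mem_sites/=[e'C /split_at_occurrence[c1' [c2' [cE' size_c1']]]] size_eq.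
have ee' : e = e'.
  apply: (insertion_context_unique eC e'C (etrans (esym cE) cE')).
  by rewrite !size_cat size_c1 size_c1'.
by move: size_eq; rewrite ee' => /addIn->.
Qed.

Definition initial_sites (c : bitseq) : nat :=
  sumn [seq nat_of_bool (prefix (fill e false) c) | e <- insertion_contexts].

Lemma size_insertion_sites_cons x c :
  size (insertion_sites (x :: c)) =
  size (insertion_sites c) + initial_sites (x :: c).
Proof.
rewrite !size_allpairs_dep /initial_sites addnC.
elim: insertion_contexts => //= e s ->.
by rewrite size_occurrences_cons addnACA.
Qed.

(* The term [2 * prefix _ c] anticipates the third context, which starts in the run
   before [c]; the last two bounds serve for an initial run of length 1 and 2. *)
Definition balanced (c : bitseq) : Prop :=
  let n := 2 * size c in let N := 2 * size (insertion_sites c) + 5 * count id c in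
  [/\ n <= N + 5, n <= N + 4 + 2 * prefix [:: false; false; true; false; false] c,
      nth true c 0 -> n <= N + 2 & nth true c 1 -> n <= N + 3].

Lemma balanced_extend_run c :
  balanced [:: false, false, false & c] -> balanced [:: false, false, false, false & c].
Proof.
rewrite /balanced (size_insertion_sites_cons _ [:: _, _, _ & c]) /initial_sites /=.
by case=> *; split=> // *; lia.
Qed.

Lemma balanced_nseq k : balanced (nseq k false).
Proof.
elim: k => [|[_|[_|[_|k IHk]]]]; last exact: balanced_extend_run.
all: by rewrite /balanced /= ?size_insertion_sites_cons.
Qed.

Lemma balanced_run k c : balanced c -> balanced (nseq k false ++ true :: c).
Proof.
move=> bal_c; elim: k => [|[_|[_|[_|k IHk]]]]; last exact: balanced_extend_run.
all: move: bal_c; rewrite /balanced [nseq _ _]/= ?cat_cons cat0s.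
all: rewrite !size_insertion_sites_cons /initial_sites /=.
all: by case: c => [|[] [|[] c]] /= [*]; rewrite ?prefix0s; split=> // *; lia.
Qed.

Lemma balanced_cat_nseq k c : balanced (nseq k false ++ c).
Proof.
elim: c k => [|[] c IHc] k; first by rewrite cats0; apply: balanced_nseq.
  by apply/balanced_run/(IHc 0).
by rewrite -cat1s catA -(nseqD k 1); apply: IHc.
Qed.

Lemma all_balanced c : balanced c.
Proof. exact: (balanced_cat_nseq 0 c). Qed.

(** * Adding a cut *)

Definition addable r (T : {set 'I_r}) : {set 'I_r} :=
  [set j : 'I_r | j.+1 \in insertion_sites (cuts T)].

Lemma addable_notin r (T : {set 'I_r}) j : j \in addable T -> j \notin T.
Proof.
rewrite inE => /split_at_insertion_site[e [c1 [c2 [_ cE jE]]]].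
by rewrite -nth_cuts cE jE /fill -!catA (catA c1) nth_cat ltnn subnn.
Qed.

Lemma addable_dominates r (T : {set 'I_r}) j : j \in addable T -> dominates (j |: T) T.
Proof.
rewrite inE => /split_at_insertion_site[e [c1 [c2 [eC cE jE]]]].
have [rule [unrule ruleP]] := insertion_context_raising_rule eC.
apply: (raising_rule_dominates ruleP _ cE); first by rewrite size_cat addnS.
rewrite cutsU1 set_nthE size_cuts !ltnS ltnW // cE jE /fill -!catA !(catA c1).
by rewrite take_size_cat // drop_cat ltnNge leqnSn subSnn /= drop0.
Qed.

Lemma size_insertion_sites_le r (T : {set 'I_r}) :
  size (insertion_sites (cuts T)) <= #|addable T|.
Proof.
rewrite cardE -(size_map (fun j : 'I_r => j.+1)).
apply: uniq_leq_size (uniq_insertion_sites _) _ => a aS.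
have [e [c1 [c2 [eC cE aE]]]] := split_at_insertion_site aS.
have a_range : 0 < a <= r.
  have := size_cuts T; rewrite cE aE /fill !size_cat /= => size_T.
  by move: eC size_T; rewrite !inE => /or3P[]/eqP-> /=; lia.
have ltar : a.-1 < r by lia.
have a_gt0 : 0 < a by lia.
by apply/mapP; exists (Ordinal ltar); rewrite ?mem_enum ?inE /= prednK.
Qed.

Lemma card_addable r (T : {set 'I_r}) : 7 * #|T| + 2 <= 2 * r -> #|T| < #|addable T|.
Proof.
have [+ _ _ _] := all_balanced (cuts T); rewrite size_cuts count_cuts.
by have := size_insertion_sites_le T; lia.
Qed.

Definition addable_extensions r (T : {set 'I_r}) : {set {set 'I_r}} :=
  [set j |: T | j in addable T].

Lemma card_addable_extensions r (T : {set 'I_r}) : #|addable_extensions T| = #|addable T|.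
Proof.
apply: card_in_imset => j k /addable_notin jT /addable_notin kT /setP/(_ j).
by rewrite !inE eqxx (negbTE jT) !orbF => /esym/eqP.
Qed.

Lemma card_addable_restrictions r d (S : {set 'I_r}) :
  #|[set T in [set T : {set 'I_r} | #|T| == d] | S \in addable_extensions T]| <= d.+1.
Proof.
set restrictions := [set T in _ | _].
have restrP T : T \in restrictions -> #|S| = d.+1 /\ T \in [set S :\ j | j in S].
  rewrite !inE => /andP[/eqP cardT /imsetP[j /addable_notin jT ->]].
  rewrite cardsU1 jT cardT; split=> //.
  by apply/imsetP; exists j; rewrite ?setU11 ?setU1K.
have [->|[T0 /restrP[cardS _]]] := set_0Vmem restrictions; first by rewrite cards0.
rewrite -cardS; apply: leq_trans (leq_imset_card (fun j => S :\ j) S).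
by apply/subset_leq_card/subsetP=> T /restrP[].
Qed.

Theorem theorem6p2 (r i : nat) (hi1 : 1 <= i) (hi2 : 7 * i <= 2 * r + 5) :
  exists phi : {set 'I_r} -> {set 'I_r},
    {in [set T : {set 'I_r} | #|T| == i.-1] &, injective phi} /\
    (forall T : {set 'I_r}, #|T| = i.-1 -> #|phi T| = i /\ dominates (phi T) T).
Proof.
pose layer := [set T : {set 'I_r} | #|T| == i.-1].
have [T|S|phi [phi_inj phiP]] :=
    @degree_matching _ _ set0 layer (@addable_extensions r) i hi1.
- rewrite inE => /eqP cardT; rewrite card_addable_extensions.
  have /card_addable : 7 * #|T| + 2 <= 2 * r by lia.
  by rewrite cardT prednK.
- by have := card_addable_restrictions i.-1 S; rewrite prednK.
exists phi; split=> // T cardT.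
have /imsetP[j jT ->] : phi T \in addable_extensions T by apply: phiP; rewrite inE cardT.
split; last exact: addable_dominates.
by rewrite cardsU1 (addable_notin jT) cardT add1n prednK.
Qed.
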